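(* Let $L>0$, $\mu\in(-\infty,L)$, $\kappa:=\mu/L$, let $N$ be a positive integer, let $\gamma>0$ with $\gamma L\in[\overline{\gamma L}_N(\kappa),2)$, and let $f(x):=L\frac{\|x\|^2}{2}$. Then $N$ iterations $x_{i+1}=x_i-\gamma\nabla f(x_i)$, $i=0,\dots,N-1$, of gradient descent on $f$ started from $x_0$ satisfy $$\frac1{2L}\min_{0\le i\le N}\{\|\nabla f(x_i)\|^2\}=\frac1{2L}\|\nabla f(x_N)\|^2=\frac{f(x_0)-f_*}{(1-\gamma L)^{-2N}},$$ where $f_*:=\inf_xf(x)$.
   Context: $f$ is a function on $\mathbb{R}^d$ with Euclidean norm $\|\cdot\|$, and $x_0\in\mathbb{R}^d$. $[x]_+:=\max\{x,0\}$. For an integer $k\ge1$ let $E_k(x):=\sum_{j=1}^{2k}x^{-j}$, $x\in\mathbb{R}\setminus\{0\}$. For $\kappa\in(-\infty,1)$, $\overline{\gamma L}_k(\kappa)$ denotes the unique root $\ell\in\big(1,\frac{2}{1+[\kappa]_+}\big)$ of $T_k(\ell,\kappa):=E_k(1-\kappa\ell)-E_k(1-\ell)=0$. *)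

(* Defs.v *)
From HB Require Import structures.
From mathcomp Require Export all_boot all_order all_algebra.
From mathcomp Require Export all_classical all_reals all_analysis.
From mathcomp Require Import zify ring lra.
Export Order.TTheory GRing.Theory Num.Theory.
Export numFieldNormedType.Exports.

Set Implicit Arguments.
Unset Strict Implicit.
Unset Printing Implicit Defensive.

Local Open Scope classical_set_scope.
Local Open Scope ring_scope.

(* The norm `|x| of 'rV[R]_d in the library is the sup norm. *)
Definition enorm (R : realType) (d : nat) (x : 'rV[R]_d) : R :=
  Num.sqrt (\sum_(i < d) x 0 i ^+ 2).

(* The vector representing the differential 'd f x for the Euclidean inner
   product. *)
Definition grad (R : realType) (d : nat) (f : 'rV[R]_d -> R) (x : 'rV[R]_d) :
  'rV[R]_d := \row_(i < d) 'd (f : 'rV[R]_d -> R^o) x (delta_mx 0 i).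

(* Only meaningful at x != 0: in the library 0^-1 = 0. *)
Definition Esum (R : realType) (k : nat) (x : R) : R :=
  \sum_(1 <= j < (2 * k).+1) x ^- j.

Definition Tdiff (R : realType) (k : nat) (l kappa : R) : R :=
  Esum k (1 - kappa * l) - Esum k (1 - l).

Definition Troots (R : realType) (k : nat) (kappa : R) : set R :=
  [set l | 1 < l < 2 / (1 + Num.max kappa 0) /\ Tdiff k l kappa = 0].

(* For 1 <= k and kappa < 1, Troots k kappa is a singleton (Troots_singleton
   below), so the default value 0 plays no role. *)
Definition gammaLbar (R : realType) (k : nat) (kappa : R) : R :=
  xget 0 (Troots k kappa).

Section GammaLbar.
Context {R : realType}.
Implicit Types (k : nat) (x l kappa : R).

Lemma mulEsum k x : x != 0 -> (x - 1) * Esum k x = 1 - x ^- (2 * k).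
Proof.
move=> x0; rewrite /Esum; elim: (2 * k)%N => [|n IH].
  by rewrite big_geq // mulr0 expr0 invr1 subrr.
rewrite big_nat_recr //= mulrDr IH !exprS.
have : x ^+ n != 0 by rewrite expf_neq0.
move: (x ^+ n) => y y0; field.
by rewrite x0 y0.
Qed.

Lemma Esum_gt0 k x : (1 <= k)%N -> 0 < x -> 0 < Esum k x.
Proof.
move=> k1 x0; rewrite /Esum big_nat_recr /=; last by lia.
rewrite ltr_wpDl ?invr_gt0 ?exprn_gt0 //.
by apply: sumr_ge0 => i _; rewrite invr_ge0 exprn_ge0 // ltW.
Qed.

Lemma Esum_le k x y : 0 < x -> x <= y -> Esum k y <= Esum k x.
Proof.
move=> x0 xy; have y0 := lt_le_trans x0 xy.
apply: ler_sum_nat => i _.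
rewrite lef_pV2 ?posrE ?exprn_gt0 //.
by apply: lerXn2r => //; rewrite nnegrE ltW.
Qed.

Lemma EsumN1 k : Esum k (-1 : R) = 0.
Proof.
have := @mulEsum k (-1); rewrite oppr_eq0 oner_eq0 exprM sqrrN expr1n expr1n.
by rewrite invr1 => /(_ isT); lra.
Qed.

Lemma Esum_opp k x : (1 <= k)%N -> 0 < x -> Esum k (- x) < Esum k x.
Proof.
move=> k1 x0; have E0 := Esum_gt0 k1 x0.
have := @mulEsum k x; rewrite gt_eqF // => /(_ isT).
have := @mulEsum k (- x); rewrite oppr_eq0 gt_eqF // => /(_ isT).
by rewrite !exprM sqrrN => <- /eqP e; move: e => /eqP; nra.
Qed.

Lemma Esum_continuous k x : x != 0 -> Esum k y @[y --> x] --> Esum k x.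
Proof.
move=> x0; rewrite /Esum; elim: (2 * k)%N => [|n IH].
  by under eq_fun do rewrite big_geq //; rewrite big_geq //; exact: cvg_cst.
under eq_fun do rewrite big_nat_recr //=.
rewrite big_nat_recr //=; apply: cvgD => //.
by apply: cvgV; [rewrite expf_neq0 | exact: exprn_continuous].
Qed.

Lemma Targ_gt0 kappa l : kappa < 1 -> 1 < l <= 2 / (1 + Num.max kappa 0) ->
  0 < 1 - kappa * l /\ l <= 2.
Proof.
move=> kappa1 /andP[l1]; rewrite ler_pdivlMr; last by case: (leP kappa 0); lra.
by case: (leP kappa 0) => h h1; split; nra.
Qed.

Lemma mul_Esum1B k l : 1 < l -> l * Esum k (1 - l) = (l - 1) ^- (2 * k) - 1.
Proof.
move=> l1; have := @mulEsum k (1 - l); rewrite subr_eq0 lt_eqF // => /(_ isT).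
by rewrite -(opprB l 1) !exprM sqrrN; lra.
Qed.

Lemma Fincr k kappa l l' : kappa < 1 -> 1 < l -> l < l' ->
  l' <= 2 / (1 + Num.max kappa 0) ->
  l * Esum k (1 - kappa * l) <= l' * Esum k (1 - kappa * l').
Proof.
move=> kappa1 l1 ll' l'b.
have [] := @Targ_gt0 kappa l kappa1; first by rewrite l1 (le_trans (ltW ll')).
have [] := @Targ_gt0 kappa l' kappa1; first by rewrite (lt_trans l1).
move=> p' _ p _.
have [k0|k0] := leP 0 kappa.
  apply: ler_pM; [lra | | lra | ]; last first.
    by apply: Esum_le => //; rewrite lerD2l lerN2 ler_wpM2l // ltW.
  by apply: sumr_ge0 => i _; rewrite invr_ge0 exprn_ge0 // ltW.
rewrite -(@ler_pM2l _ (- kappa)) ?oppr_gt0 //.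
have := @mulEsum k (1 - kappa * l); rewrite gt_eqF // => /(_ isT).
have := @mulEsum k (1 - kappa * l'); rewrite gt_eqF // => /(_ isT).
have : (1 - kappa * l') ^- (2 * k) <= (1 - kappa * l) ^- (2 * k).
  rewrite lef_pV2 ?posrE ?exprn_gt0 //.
  apply: lerXn2r; rewrite ?nnegrE; [exact: ltW | exact: ltW | ].
  by rewrite lerD2l lerN2 ler_wnM2l ?ltW.
set a := _ ^- _; set b := _ ^- _; set u := Esum _ _; set v := Esum _ _.
by lra.
Qed.

Lemma Gdecr k l l' : (1 <= k)%N -> 1 < l -> l < l' ->
  l' * Esum k (1 - l') < l * Esum k (1 - l).
Proof.
move=> k1 l1 ll'; have l'1 := lt_trans l1 ll'.
rewrite !mul_Esum1B // ltrD2r ltf_pV2 ?posrE ?exprn_gt0 ?subr_gt0 //.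
rewrite ltrXn2r; first by lia.
- by lra.
- by lra.
Qed.

Lemma Troots_unique k kappa l l' : (1 <= k)%N -> kappa < 1 ->
  Troots k kappa l -> Troots k kappa l' -> l = l'.
Proof.
move=> k1 kappa1.
wlog : l l' / l < l' => [hwlog|ll'].
  by case: (ltgtP l l') => // h r r'; [|symmetry]; apply: hwlog.
move=> [/andP[l1 lb] /subr0_eq e] [/andP[l'1 l'b] /subr0_eq e'].
have := @Fincr k _ _ _ kappa1 l1 ll' (ltW l'b).
by rewrite e e' leNgt Gdecr.
Qed.

Lemma Troots_exists k kappa : (1 <= k)%N -> kappa < 1 ->
  exists l, Troots k kappa l.
Proof.
move=> k1 kappa1.
set b := 2 / (1 + Num.max kappa 0).
have b1 : 1 < b by rewrite /b ltr_pdivlMr; case: (leP kappa 0); lra.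
have [cb _] : 0 < 1 - kappa * b /\ b <= 2.
  by apply: Targ_gt0 => //; rewrite b1 lexx.
have Tb : 0 < Tdiff k b kappa.
  rewrite /Tdiff subr_gt0; move: cb; rewrite /b; case: (leP kappa 0) => k0 cb.
    rewrite addr0 divr1 in cb *; rewrite (_ : 1 - 2 = -1); last by lra.
    by rewrite EsumN1; exact: Esum_gt0.
  have -> : 1 - 2 / (1 + kappa) = - (1 - kappa * (2 / (1 + kappa))).
    by field; lra.
  exact: Esum_opp.
pose M := b * Esum k (1 - kappa * b).
have M0 : 0 < M.
  by rewrite /M mulr_gt0 ?Esum_gt0 //; lra.
pose y := Num.min ((b - 1) / 2) (M + 2)^-1.
have y0 : 0 < y by rewrite /y lt_min invr_gt0; lra.
have yb : y < b - 1 by rewrite /y gt_min; apply/orP; left; lra.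
have yM : M + 2 <= y^-1.
  by rewrite -[leLHS]invrK lef_pV2 ?posrE ?invr_gt0 // ?ge_min ?lexx ?orbT //; lra.
have y1 : y <= 1.
  rewrite -[leRHS]invr1 -[leLHS]invrK lef_pV2 ?posrE ?invr_gt0 //; lra.
have Ta : Tdiff k (1 + y) kappa < 0.
  rewrite /Tdiff subr_lt0 -(@ltr_pM2l _ (1 + y)); last by lra.
  rewrite mul_Esum1B; last by lra.
  have h : (1 + y) * Esum k (1 - kappa * (1 + y)) <= M.
    by apply: Fincr => //; lra.
  apply: (le_lt_trans h); rewrite (addrAC 1) subrr add0r.
  have : y^-1 <= y ^- (2 * k).
    rewrite lef_pV2 ?posrE ?exprn_gt0 // -[leRHS]expr1.
    by apply: ler_wiXn2l => //; [exact: ltW | lia].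
  by move: (y ^- _) => z; lra.
have ab : 1 + y <= b by lra.
have cont : {within `[1 + y, b], continuous (fun l => Tdiff k l kappa)}.
  apply: continuous_in_subspaceT => l; rewrite inE /= in_itv /= => /andP[yl lb].
  have [cl _] : 0 < 1 - kappa * l /\ l <= 2.
    by apply: Targ_gt0 => //; apply/andP; split; [lra | exact: lb].
  have h a : a * z @[z --> l] --> a * l.
    by apply: cvgM; [exact: cvg_cst | exact: cvg_id].
  have c1 a : 1 - a * l != 0 -> Esum k (1 - a * z) @[z --> l] --> Esum k (1 - a * l).
    move=> al; apply: (@cvg_comp _ _ _ (fun z => 1 - a * z) (@Esum R k)).
      by apply: cvgB; [exact: cvg_cst | exact: h].
    exact: Esum_continuous.
  apply: cvgB; first by apply: c1; rewrite gt_eqF.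
  have := c1 1; rewrite mul1r; under eq_fun do rewrite mul1r.
  by apply; rewrite lt_eqF //; lra.
have [|c cab Tc] := @IVT R _ _ _ 0 ab cont.
  by rewrite ge_min le_max (ltW Ta) (ltW Tb) orbT.
exists c; split => //; move: cab; rewrite in_itv /= => /andP[ac ltcb].
apply/andP; split; first by lra.
rewrite lt_neqAle ltcb andbT; apply/eqP => ceb.
by move: Tb; rewrite -(ceb : c = b) Tc ltxx.
Qed.

Lemma Troots_singleton k kappa : (1 <= k)%N -> kappa < 1 ->
  Troots k kappa = [set gammaLbar k kappa].
Proof.
move=> k1 kappa1.
have gP : Troots k kappa (gammaLbar k kappa).
  by apply: xgetPex; exact: Troots_exists.
apply/seteqP; split => [l lP /=|l /= ->//].
exact: (Troots_unique k1 kappa1 lP gP).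
Qed.

End GammaLbar.

(* Main.v *)
From HB Require Import structures.
From mathcomp Require Import ring lra.
Require Import Defs.

(** Since grad f y = L y, a gradient step multiplies the iterate by the scalar
    q = 1 - gamma L, so x_i = q^i x_0 and the i-th squared gradient norm is
    L^2 q^(2i) |x_0|^2. For 0 < gamma L < 2 one has q^2 <= 1: the gradient
    norms decrease along the iterations, so the last one is the smallest. Both
    sides of the second equality are then L q^(2N) |x_0|^2 / 2, because
    inf f = 0, attained at the origin.

    The only analytic point is that grad, which is built from the Frechet
    differential, really is L y here ([grad_quadratic]); this needs f to be
    differentiable, since the differential of a map that is not differentiable
    carries no information. *)

Local Open Scope classical_set_scope.
Local Open Scope ring_scope.

Section Enorm.
Context {R : realType} {d : nat}.
Implicit Types (x y : 'rV[R]_d) (a : R).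

Lemma enorm_sqr x : enorm x ^+ 2 = \sum_(i < d) x 0 i ^+ 2.
Proof. by rewrite sqr_sqrtr // sumr_ge0 // => i _; exact: sqr_ge0. Qed.

Lemma enormZ_sqr a x : enorm (a *: x) ^+ 2 = a ^+ 2 * enorm x ^+ 2.
Proof.
by rewrite !enorm_sqr mulr_sumr; apply: eq_bigr => i _; rewrite mxE exprMn.
Qed.

Lemma enorm0 : enorm (0 : 'rV[R]_d) = 0.
Proof.
by apply/eqP; rewrite -sqrf_eq0 enorm_sqr big1 // => i _; rewrite mxE expr0n.
Qed.

End Enorm.

Section Quadratic.
Context {R : realType} {d : nat}.
Implicit Types (x y : 'rV[R]_d) (L : R) (f : 'rV[R]_d -> R).

(** A coordinate is a continuous linear map, hence its own differential. *)
Lemma is_diff_coord (i : 'I_d) x :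
  is_diff x (fun y => y 0 i : R^o) (fun y => y 0 i : R^o).
Proof.
have lin : linear (fun y : 'rV[R]_d => y 0 i : R^o).
  by move=> a u v; rewrite !mxE.
pose coord : {linear 'rV[R]_d -> R^o} :=
  HB.pack (fun y : 'rV[R]_d => y 0 i : R^o)
    (GRing.isLinear.Build _ _ _ _ _ lin).
have coord_cont : continuous coord by exact: coord_continuous.
apply: DiffDef; first exact: (@linear_differentiable _ _ _ coord).
by rewrite (@diff_lin _ _ _ coord).
Qed.

Lemma is_diff_sum (n : nat) (F dF : 'I_n -> 'rV[R]_d -> R^o) x :
  (forall i, is_diff x (F i) (dF i)) ->
  is_diff x (\sum_(i < n) F i) (\sum_(i < n) dF i).
Proof.
by move=> FdF; elim/big_ind2 : _ => // *; [exact: is_diff_cst|exact: is_diffD].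
Qed.

Lemma grad_quadratic L f y :
  (forall z, f z = L * (enorm z ^+ 2 / 2)) -> grad f y = L *: y.
Proof.
move=> fE.
have -> : f = (L / 2) *:
    \sum_(i < d) ((fun z : 'rV[R]_d => z 0 i : R^o) ^+ 2 : 'rV[R]_d -> R^o).
  apply/funext => z; rewrite fE enorm_sqr.
  by rewrite -[RHS]/(L / 2 * _) fct_sumE mulrA mulrAC.
have isd := is_diffZ (L / 2)
  (is_diff_sum _ _ _ _ (fun i => is_diffX 1 (is_diff_coord i y))).
apply/rowP => j; rewrite !mxE (@diff_val _ _ _ _ _ _ _ isd).
rewrite -[LHS]/(L / 2 * _) fct_sumE (bigD1 j) //= big1 => [|i ij].
  rewrite addr0 -[X in _ * X]/(_ * (delta_mx 0 j : 'rV[R]_d) 0 j) mxE !eqxx.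
  by rewrite expr1 mulr1 mulrA divfK.
by rewrite -[LHS]/(_ * (delta_mx 0 j : 'rV[R]_d) 0 i) mxE (negbTE ij) mulr0.
Qed.

Lemma inf_quadratic L f : 0 <= L ->
  (forall z, f z = L * (enorm z ^+ 2 / 2)) -> inf (range f) = 0.
Proof.
move=> L0 fE; have f_ge0 : lbound (range f) 0.
  by move=> _ [z _ <-]; rewrite fE mulr_ge0 // divr_ge0 // sqr_ge0.
apply/le_anti/andP; split.
  apply: ge_inf; first by exists 0.
  by exists 0 => //; rewrite fE enorm0 expr0n mul0r mulr0.
by apply: lb_le_inf => //; exists (f 0); exists 0.
Qed.

Lemma gradient_descent_quadratic L gamma (N : nat) f (x : nat -> 'rV[R]_d) :
  (forall z, f z = L * (enorm z ^+ 2 / 2)) ->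
  (forall i, (i < N)%N -> x i.+1 = x i - gamma *: grad f (x i)) ->
  forall i, (i <= N)%N -> x i = (1 - gamma * L) ^+ i *: x 0%N.
Proof.
move=> fE x_step; elim=> [|i IH] iN; first by rewrite expr0 scale1r.
rewrite x_step // (grad_quadratic _ _ _ fE) scalerA -{1}(scale1r (x i)) -scalerBl.
by rewrite IH ?scalerA -?exprS // ltnW.
Qed.

End Quadratic.

(** The default value u 0 of the iterated minimum is one of the values of u, so
    it does not lower the minimum. *)
Lemma bigmin_geometric (R : realType) (a q : R) (u : nat -> R) (N : nat) :
  0 <= a -> 0 <= q <= 1 -> (forall i, (i <= N)%N -> u i = a * q ^+ i) ->
  \big[Num.min/u 0%N]_(0 <= i < N.+1) u i = u N.
Proof.
move=> a0 /andP[q0 q1] uE.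
have uN i : (i <= N)%N -> u N <= u i.
  by move=> iN; rewrite (uE i iN) uE // ler_wpM2l // ler_wiXn2l.
apply/le_anti/andP; split.
  by apply: ge_bigmin_seq => //; rewrite mem_index_iota ltnSn.
rewrite big_seq; apply: le_bigmin => [|i]; first exact: uN.
by rewrite mem_index_iota ltnS => /= /uN.
Qed.

Theorem proposition5p2 (R : realType) (d : nat) (L mu gamma : R) (N : nat)
    (f : 'rV[R]_d -> R) (x0 : 'rV[R]_d) (x : nat -> 'rV[R]_d)
    (L_gt0 : 0 < L) (mu_lt_L : mu < L) (N_gt0 : (0 < N)%N)
    (gamma_gt0 : 0 < gamma)
    (gammaL_ge : gammaLbar N (mu / L) <= gamma * L) (gammaL_lt : gamma * L < 2)
    (fE : forall y, f y = L * (enorm y ^+ 2 / 2))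
    (x_init : x 0%N = x0)
    (x_step : forall i, (i < N)%N -> x i.+1 = x i - gamma *: grad f (x i)) :
  1 / (2 * L) * (\big[Num.min/enorm (grad f (x 0%N)) ^+ 2]_(0 <= i < N.+1)
                   enorm (grad f (x i)) ^+ 2)
    = 1 / (2 * L) * enorm (grad f (x N)) ^+ 2
  /\ 1 / (2 * L) * enorm (grad f (x N)) ^+ 2
    = (f x0 - inf (range f)) / (1 - gamma * L) ^- (2 * N).
Proof.
have gradE i : (i <= N)%N -> enorm (grad f (x i)) ^+ 2 =
    L ^+ 2 * enorm x0 ^+ 2 * ((1 - gamma * L) ^+ 2) ^+ i.
  move=> iN; rewrite (grad_quadratic _ _ _ fE) enormZ_sqr.
  rewrite (gradient_descent_quadratic _ _ _ _ _ fE x_step _ iN) x_init.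
  by rewrite enormZ_sqr -!exprM mulnC mulrA mulrAC.
have gammaL_gt0 : 0 < gamma * L by exact: mulr_gt0.
have q_le1 : (1 - gamma * L) ^+ 2 <= 1 by nra.
split.
  congr (_ * _); apply: bigmin_geometric gradE.
    by apply: mulr_ge0; exact: sqr_ge0.
  by apply/andP; split; [exact: sqr_ge0 | exact: q_le1].
rewrite (gradE N (leqnn N)) (inf_quadratic _ _ (ltW L_gt0) fE) subr0 invrK fE.
rewrite exprM; move: (enorm x0) (((1 - gamma * L) ^+ 2) ^+ N) => e q.
by field; rewrite gt_eqF.
Qed.
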